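(* Let $\mathcal G$ and $\mathcal G'$ be iCGS defined on the same set $Ag$ of agents and the same set $AP$ of atoms, with state sets $S$ and $S'$, let $A\subseteq Ag$ be a coalition, and let $R\subseteq S\times S'$ be an $A$-bisimulation. Let $q\in S$ and $q'\in S'$ be states with $q\,R\,q'$, and let $\lambda$ and $\lambda'$ be infinite runs of $\mathcal G$ and $\mathcal G'$ respectively such that $\lambda[j]\,R\,\lambda'[j]$ for every $j\ge 0$. Then, for $x\in\{subj,obj\}$, for every state $A$-formula $\phi$ and every path $A$-formula $\psi$ of ATL$^*$, $$(\mathcal G,q)\models_x\phi \iff (\mathcal G',q')\models_x\phi,\qquad (\mathcal G,\lambda)\models_x\psi \iff (\mathcal G',\lambda')\models_x\psi .$$
   Context: **iCGS.** A concurrent game structure with imperfect information (iCGS) is a tuple $\mathcal G=\langle Ag,AP,S,s_0,Act,\{\sim_i\}_{i\in Ag},d,\to,\pi\rangle$ where: $Ag$ is a nonempty finite set of agents (subsets $A\subseteq Ag$ are called coalitions); $AP$ is a set of atoms; $S$ is a nonempty set of states and $s_0\in S$; $Act$ is a finite nonempty set of actions, and a joint action is a tuple $\vec a=(a_i)_{i\in Ag}\in Act^{Ag}$; each $\sim_i$ is an equivalence relation on $S$; $d:Ag\times S\to 2^{Act}\setminus\{\emptyset\}$ satisfies $d(i,s)=d(i,s')$ whenever $s\sim_i s'$; $\to\subseteq S\times Act^{Ag}\times S$ is such that for all $s\in S$ and $\vec a\in Act^{Ag}$, there is $s'$ with $(s,\vec a,s')\in\to$ (written $s\xrightarrow{\vec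 a}s'$) iff $a_i\in d(i,s)$ for every $i\in Ag$; and $\pi:S\to 2^{AP}$. Components of $\mathcal G'$ are written with primes. **Runs.** A run is a finite or infinite sequence $\lambda=s_0\vec a_0s_1\vec a_1\ldots$ with $s_j\xrightarrow{\vec a_j}s_{j+1}$ for all $j$; $\lambda[j]=s_j$ and $\lambda_{\ge j}=s_j\vec a_js_{j+1}\ldots$. **Knowledge.** $\sim^E_A=\bigcup_{i\in A}\sim_i$, and $\sim^C_A$ is the transitive closure of $\sim^E_A$, regarded as an equivalence relation on $S$; $C_A(q)=\{q'\in S\mid q'\sim^C_A q\}$ is the common knowledge neighbourhood of $q$ ($C'_A$ denotes the one in $\mathcal G'$). **Strategies.** A (uniform) strategy for agent $i$ is a function $\sigma:S\to Act$ with $\sigma(s)\in d(i,s)$ for all $s$, and $\sigma(s)=\sigma(s')$ whenever $s\sim_i s'$. A partial (uniform) strategy for $i$ is a partial function $\sigma:S\to Act$ with the same two properties on its domain $dom(\sigma)$. A (partial) strategy for $A$ is a tuple $\sigma_A=(\sigma_i)_{i\in A}$ of (partial) strategies. For $Q\subseteq S$, $PStr_A(Q)$ is the set of partial strategies $(\sigma_i)_{i\in A}$ for $A$ with $dom(\sigma_i)=Q$ for all $i\in A$. Write $s\xrightarrow{\sigma_A(s)}r$ if $s\xrightarrow{\vec a}r$ for some joint action $\vec a$ with $a_i=\sigma_i(s)$ for all $i\in A$, and $succ(s,\sigma_A)=\{r\in S\mid s\xrightarrow{\sigma_A(s)}r\}$. **Outcomes.** $out^{\mathcal G}_{obj}(s,\sigma_A)$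 is the set of infinite runs $\lambda$ with $\lambda[0]=s$ and $\lambda[j]\xrightarrow{\sigma_A(\lambda[j])}\lambda[j+1]$ for all $j\ge0$; $out^{\mathcal G}_{subj}(s,\sigma_A)=\bigcup_{i\in A,\,s'\sim_i s}out^{\mathcal G}_{obj}(s',\sigma_A)$. **ATL$^*$.** State formulas: $\phi::=p\mid\neg\phi\mid\phi\to\phi\mid\langle\!\langle A\rangle\!\rangle\psi$; path formulas: $\psi::=\phi\mid\neg\psi\mid\psi\to\psi\mid X\psi\mid\psi U\psi$ ($p\in AP$, $A\subseteq Ag$). $A$-formulas are the formulas in which $A$ is the only coalition appearing in modalities. Semantics for $x\in\{subj,obj\}$: $(\mathcal G,s)\models_x p$ iff $p\in\pi(s)$; Boolean connectives as usual; $(\mathcal G,s)\models_x\langle\!\langle A\rangle\!\rangle\psi$ iff there is a strategy $\sigma_A$ such that $(\mathcal G,\lambda)\models_x\psi$ for all $\lambda\in out^{\mathcal G}_x(s,\sigma_A)$; for a state formula $\phi$, $(\mathcal G,\lambda)\models_x\phi$ iff $(\mathcal G,\lambda[0])\models_x\phi$; $(\mathcal G,\lambda)\models_x X\psi$ iff $(\mathcal G,\lambda_{\ge1})\models_x\psi$; $(\mathcal G,\lambda)\models_x\psi U\psi'$ iff for some $j\ge0$, $(\mathcal G,\lambda_{\ge j})\models_x\psi'$ and $(\mathcal G,\lambda_{\ge k})\models_x\psi$ for all $0\le k<j$. **Simulation.** A simulator of partial strategies for $A$ with respect to $R\subseteq S\times S'$ is a family $ST$ of functions $ST_{C_A(q),C'_A(q')}:PStr_A(C_A(q))\to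 PStr_A(C'_A(q'))$, one for each pair of neighbourhoods $C_A(q),C'_A(q')$ with $q\,R\,q'$ (the function depends only on the pair of neighbourhoods). $R$ is a simulation for $A$ (from $\mathcal G$ to $\mathcal G'$) iff: (1) there exists a simulator $ST$ of partial strategies for $A$ w.r.t. $R$ such that $q\,R\,q'$ implies: (a) $\pi(q)=\pi'(q')$; (b) for every $i\in A$ and $r'\in S'$, if $q'\sim'_i r'$ then for some $r\in S$, $q\sim_i r$ and $r\,R\,r'$; (c) for all $r\in C_A(q)$, $r'\in C'_A(q')$ with $r\,R\,r'$, every $\sigma_A\in PStr_A(C_A(q))$ and every $s'\in succ(r',ST_{C_A(q),C'_A(q')}(\sigma_A))$, there is $s\in succ(r,\sigma_A)$ with $s\,R\,s'$; (2) if $q_1\,R\,q'$ and $q_2\,R\,q'$ then $C_A(q_1)=C_A(q_2)$. $R$ is an $A$-bisimulation iff both $R$ and its converse $R^{-1}$ (from $\mathcal G'$ to $\mathcal G$) are simulations for $A$. *)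

(* Defs.v *)
From mathcomp Require Import all_boot.
From mathcomp Require Import boolp classical_sets.
From Stdlib Require Import Relations.

Set Implicit Arguments.
Unset Strict Implicit.
Unset Printing Implicit Defensive.

Local Open Scope classical_set_scope.

Record iCGS (Ag : finType) (AP : Type) := ICGS {
  agents_nonempty : (0 < #|Ag|)%N;
  state : Type;
  init : state;
  action : finType;
  action_nonempty : (0 < #|action|)%N;
  indist : Ag -> relation state;
  indist_equiv : forall i, equivalence state (indist i);
  avail : Ag -> state -> {set action};
  avail_nonempty : forall i s, avail i s != finset.set0;
  avail_indist : forall i s s', indist i s s' -> avail i s = avail i s';
  trans : state -> {ffun Ag -> action} -> state -> Prop;
  trans_avail : forall s (a : {ffun Ag -> action}),
    (exists s', trans s a s') <-> (forall i, a i \in avail i s);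
  label : state -> set AP
}.

(* Infinite runs only: finite ones play no role in the semantics. *)
Record run (Ag : finType) (AP : Type) (G : iCGS Ag AP) := Run {
  run_state :> nat -> state G;
  run_action : nat -> {ffun Ag -> action G};
  run_trans : forall j, trans (run_state j) (run_action j) (run_state j.+1)
}.

Section Games.
Variables (Ag : finType) (AP : Type) (G : iCGS Ag AP).

Definition suffix (l : run G) (j : nat) : run G :=
  @Run _ _ G (fun k => l (j + k)%N) (fun k => run_action l (j + k)%N)
    (fun k => eq_ind_r (fun n => trans (l (j + k)%N) (run_action l (j + k)%N) (l n))
                (run_trans l (j + k)%N) (addnS j k)).

Definition everybody (A : {set Ag}) : relation (state G) :=
  fun s s' => exists2 i, i \in A & indist i s s'.

(* The reflexive closure matters only for the empty coalition, for which
   [everybody] is the empty relation: see [common_clos_trans]. *)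
Definition common (A : {set Ag}) : relation (state G) :=
  clos_refl_trans (state G) (everybody A).

Lemma common_equiv (A : {set Ag}) : equivalence (state G) (common A).
Proof.
split; first by move=> s; apply: rt_refl.
  by move=> s t u; apply: rt_trans.
move=> s t; elim=> [u v [i iA uv]|u|u v w _ vu _ wv].
- by apply: rt_step; exists i => //; apply: (equiv_sym _ _ (indist_equiv G i)).
- exact: rt_refl.
- exact: rt_trans wv vu.
Qed.

Lemma common_clos_trans (A : {set Ag}) (s s' : state G) : A != finset.set0 ->
  common A s s' <-> clos_trans (state G) (everybody A) s s'.
Proof.
case/set0Pn=> i iA; split.
  elim=> [u v uv|u|u v w _ uv _ vw]; first exact: t_step.
  - by apply: t_step; exists i => //; apply: (equiv_refl _ _ (indist_equiv G i)).
  - exact: t_trans uv vw.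
elim=> [u v uv|u v w _ uv _ vw]; first exact: rt_step.
exact: rt_trans uv vw.
Qed.

Definition nbhd (A : {set Ag}) (q : state G) : set (state G) :=
  [set q' | common A q' q].

Definition uniform (i : Ag) (sigma : state G -> action G) : Prop :=
  (forall s, sigma s \in avail i s) /\
  (forall s s', indist i s s' -> sigma s = sigma s').

Definition dom (sigma : state G -> option (action G)) : set (state G) :=
  [set s | sigma s <> None].

Definition partial_uniform (i : Ag) (sigma : state G -> option (action G)) : Prop :=
  (forall s a, sigma s = Some a -> a \in avail i s) /\
  (forall s s', dom sigma s -> dom sigma s' -> indist i s s' ->
     sigma s = sigma s').

(* Tuples indexed by the members of the coalition. *)
Definition profile (A : {set Ag}) : Type :=
  {i : Ag | i \in A} -> state G -> action G.
Definition partial_profile (A : {set Ag}) : Type :=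
  {i : Ag | i \in A} -> state G -> option (action G).

Definition Str (A : {set Ag}) : set (profile A) :=
  [set sigma | forall i, uniform (val i) (sigma i)].

Definition PStr (A : {set Ag}) (Q : set (state G)) : set (partial_profile A) :=
  [set sigma | forall i, partial_uniform (val i) (sigma i) /\ dom (sigma i) = Q].

Definition to_partial (A : {set Ag}) (sigma : profile A) : partial_profile A :=
  fun i s => Some (sigma i s).

Definition succ (A : {set Ag}) (s : state G) (sigma : partial_profile A) :
    set (state G) :=
  [set r | exists2 a : {ffun Ag -> action G},
     trans s a r & forall i, sigma i s = Some (a (val i))].

Definition out_obj (A : {set Ag}) (s : state G) (sigma : profile A) :
    set (run G) :=
  [set l | l 0%N = s /\ forall j, succ (l j) (to_partial sigma) (l j.+1)].

Definition out_subj (A : {set Ag}) (s : state G) (sigma : profile A) :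
    set (run G) :=
  \bigcup_(i in [set i | i \in A]) \bigcup_(s' in [set s' | indist i s' s])
    out_obj s' sigma.

End Games.

Inductive semantics := subj | obj.

Definition out (x : semantics) (Ag : finType) (AP : Type) (G : iCGS Ag AP)
    (A : {set Ag}) (s : state G) (sigma : profile G A) : set (run G) :=
  match x with
  | subj => out_subj s sigma
  | obj => out_obj s sigma
  end.

Inductive state_formula (Ag : finType) (AP : Type) : Type :=
  | Atom of AP
  | SNot of state_formula Ag AP
  | SImp of state_formula Ag AP & state_formula Ag AP
  | Can of {set Ag} & path_formula Ag AP
with path_formula (Ag : finType) (AP : Type) : Type :=
  | PState of state_formula Ag AP
  | PNot of path_formula Ag AP
  | PImp of path_formula Ag AP & path_formula Ag AP
  | Next of path_formula Ag AP
  | Until of path_formula Ag AP & path_formula Ag AP.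

Fixpoint state_only (Ag : finType) (AP : Type) (A : {set Ag})
    (phi : state_formula Ag AP) : Prop :=
  match phi with
  | Atom _ => True
  | SNot phi1 => state_only A phi1
  | SImp phi1 phi2 => state_only A phi1 /\ state_only A phi2
  | Can B psi => B = A /\ path_only A psi
  end
with path_only (Ag : finType) (AP : Type) (A : {set Ag})
    (psi : path_formula Ag AP) : Prop :=
  match psi with
  | PState phi => state_only A phi
  | PNot psi1 => path_only A psi1
  | PImp psi1 psi2 => path_only A psi1 /\ path_only A psi2
  | Next psi1 => path_only A psi1
  | Until psi1 psi2 => path_only A psi1 /\ path_only A psi2
  end.

Fixpoint state_sat (x : semantics) (Ag : finType) (AP : Type) (G : iCGS Ag AP)
    (s : state G) (phi : state_formula Ag AP) : Prop :=
  match phi with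
  | Atom p => label s p
  | SNot phi1 => ~ state_sat x s phi1
  | SImp phi1 phi2 => state_sat x s phi1 -> state_sat x s phi2
  | Can B psi => exists2 sigma : profile G B, Str sigma &
      forall l, out x s sigma l -> path_sat x l psi
  end
with path_sat (x : semantics) (Ag : finType) (AP : Type) (G : iCGS Ag AP)
    (l : run G) (psi : path_formula Ag AP) : Prop :=
  match psi with
  | PState phi => state_sat x (l 0%N) phi
  | PNot psi1 => ~ path_sat x l psi1
  | PImp psi1 psi2 => path_sat x l psi1 -> path_sat x l psi2
  | Next psi1 => path_sat x (suffix l 1) psi1
  | Until psi1 psi2 => exists2 j, path_sat x (suffix l j) psi2 &
      forall k, (k < j)%N -> path_sat x (suffix l k) psi1
  end.

Section Bisimulation.
Variables (Ag : finType) (AP : Type).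

(* [ST C C'] is constrained only on [PStr A C], for neighbourhoods [C] and [C']
   of related states; its other values are irrelevant. *)
Definition simulator (G G' : iCGS Ag AP) (A : {set Ag})
    (R : state G -> state G' -> Prop)
    (ST : set (state G) -> set (state G') ->
          partial_profile G A -> partial_profile G' A) : Prop :=
  forall q q', R q q' -> forall sigma : partial_profile G A,
    PStr (nbhd A q) sigma ->
    PStr (nbhd A q') (ST (nbhd A q) (nbhd A q') sigma).

Definition simulation (G G' : iCGS Ag AP) (A : {set Ag})
    (R : state G -> state G' -> Prop) : Prop :=
  (exists2 ST, @simulator G G' A R ST &
    forall q q', R q q' ->
      [/\ label q = label q',
          forall i r', i \in A -> indist i q' r' ->
            exists2 r, indist i q r & R r r'
        & forall r r', nbhd A q r -> nbhd A q' r' -> R r r' ->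
            forall sigma : partial_profile G A, PStr (nbhd A q) sigma ->
            forall s', succ r' (ST (nbhd A q) (nbhd A q') sigma) s' ->
            exists2 s, succ r sigma s & R s s'])
  /\ (forall q1 q2 q', R q1 q' -> R q2 q' -> nbhd A q1 = nbhd A q2).

Definition bisimulation (G G' : iCGS Ag AP) (A : {set Ag})
    (R : state G -> state G' -> Prop) : Prop :=
  simulation A R /\ simulation A (fun q' q => R q q').

End Bisimulation.

(* Main.v *)
(** A strategy of [G] is transferred to [G'] one common knowledge neighbourhood
    at a time.  By (1b) and (2), all states of [G] related to states of a given
    neighbourhood [C'] of [G'] lie in a single neighbourhood [C], so on [C'] one
    can play the image under the simulator of the restriction of the strategy
    to [C]; neighbourhoods without related states are played arbitrarily.  By
    (1c), every outcome of the resulting strategy is pointwise related to an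
    outcome of the original one, and the theorem follows by induction on
    formulas. *)
Require Import Defs.
From mathcomp Require Import all_boot.
From mathcomp Require Import boolp classical_sets.
From Stdlib Require Import Relations.

Set Implicit Arguments.
Unset Strict Implicit.
Unset Printing Implicit Defensive.

Local Open Scope classical_set_scope.

(** * Common knowledge neighbourhoods, restricted and default strategies *)

Section Neighbourhoods.
Variables (Ag : finType) (AP : Type) (G : iCGS Ag AP) (A : {set Ag}).
Implicit Types (q r s : state G) (sigma : profile G A).

Lemma indist_sym i r s : indist i r s -> indist i s r.
Proof. exact: (equiv_sym _ _ (indist_equiv G i)). Qed.

Lemma common_sym r s : common A r s -> common A s r.
Proof. exact: (equiv_sym _ _ (common_equiv G A)). Qed.

Lemma indist_common i r s : i \in A -> indist i r s -> common A r s.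
Proof. by move=> iA rs; apply: rt_step; exists i. Qed.

Lemma nbhd_refl q : nbhd A q q.
Proof. exact: rt_refl. Qed.

Lemma eq_nbhd r s : common A r s -> nbhd A r = nbhd A s.
Proof.
move=> rs; apply/seteqP; split=> t /= tr; first exact: rt_trans tr rs.
exact: rt_trans tr (common_sym rs).
Qed.

Definition restrict (C : set (state G)) sigma : partial_profile G A :=
  fun i s => if `[< C s >] then Some (sigma i s) else None.

Lemma restrictE (C : set (state G)) sigma i s : C s ->
  restrict C sigma i s = Some (sigma i s).
Proof. by move=> Cs; rewrite /restrict asboolT. Qed.

Lemma restrict_PStr (C : set (state G)) sigma :
  Str sigma -> PStr C (restrict C sigma).
Proof.
move=> sigmaP i; have [sigma_avail sigma_unif] := sigmaP i.
have domP s : dom (restrict C sigma i) s <-> C s.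
  by rewrite /dom /restrict /=; case: asboolP; split.
split; last by apply/seteqP; split=> s /domP.
split=> [s a|s s' /domP Cs /domP Cs' ss'].
  by rewrite /restrict; case: asboolP => // _ [<-].
by rewrite !restrictE // (sigma_unif _ _ ss').
Qed.

Lemma exists_avail i s : exists a, a \in avail i s.
Proof. by apply/set0Pn; apply: avail_nonempty. Qed.

(* [xchoose] depends only on the set [avail i s], whence uniformity. *)
Definition default_action i s : action G := xchoose (exists_avail i s).

Lemma default_action_avail i s : default_action i s \in avail i s.
Proof. exact: xchooseP. Qed.

Lemma default_action_indist i r s :
  indist i r s -> default_action i r = default_action i s.
Proof. by move=> rs; apply: eq_xchoose => a; rewrite (avail_indist rs). Qed.

End Neighbourhoods.

(** * Transfer of strategies and outcomes along a simulation *)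

Section Transfer.
Variables (Ag : finType) (AP : Type) (G G' : iCGS Ag AP) (A : {set Ag}).
Variable R : state G -> state G' -> Prop.
Hypothesis simR : simulation A R.

Lemma simulation_label q q' : R q q' -> label q = label q'.
Proof. by case: simR => [[ST _ STP] _] /STP[]. Qed.

Lemma simulation_indist i q q' r' : i \in A -> R q q' -> indist i q' r' ->
  exists2 r, indist i q r & R r r'.
Proof. by case: simR => [[ST _ STP] _] iA /STP[_ h _]; apply: h. Qed.

(** Each indistinguishability step of the chain from [q'] to [r'] is pulled back by (1b). *)
Lemma simulation_common q q' r' : R q q' -> common A q' r' ->
  exists2 r, common A q r & R r r'.
Proof.
move=> + q'r'; elim: q'r' q => [u v [i iA uv]|u|u v w _ IHuv _ IHvw] q Rq.
- have [r qr Rr] := simulation_indist iA Rq uv.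
  by exists r => //; apply: indist_common qr.
- by exists q => //; apply: rt_refl.
- have [r qr /IHvw[s rs Rs]] := IHuv _ Rq.
  by exists s => //; apply: rt_trans qr rs.
Qed.

(** Pulling [r2'] back from [r1] gives a state in the neighbourhood of [r1] that is related to
    [r2'], as [r2] is; (2) then applies. *)
Lemma simulation_nbhd r1 r2 r1' r2' : R r1 r1' -> R r2 r2' ->
  common A r1' r2' -> nbhd A r1 = nbhd A r2.
Proof.
move=> R1 R2 /(simulation_common R1)[r /eq_nbhd-> Rr].
by case: simR => _; apply; [exact: Rr|exact: R2].
Qed.

Lemma simulation_strategy (sigma : profile G A) : Str sigma ->
  exists2 sigma' : profile G' A, Str sigma' &
    forall r r' s', R r r' -> succ r' (to_partial sigma') s' ->
      exists2 s, succ r (to_partial sigma) s & R s s'.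
Proof.
move=> sigmaP; have [[ST STsim STP] _] := simR.
(* Any related state will do: by [simulation_nbhd], its neighbourhood does not depend on the choice.
   [init G] is a dummy value. *)
have /choice[f fP] r' : exists r, (exists s, R s r') -> R r r'.
  have [[r Rr]|noR] := pselect (exists s, R s r'); first by exists r.
  by exists (init G) => /noR.
pose tau C C' := ST C C' (restrict C sigma).
have tauP r r' : R r r' -> PStr (nbhd A r') (tau (nbhd A r) (nbhd A r')).
  by move=> Rr; apply: STsim Rr _ _; apply: restrict_PStr.
pose sigma' : profile G' A := fun i r' =>
  if `[< exists r, R r r' >] then
    odflt (default_action (val i) r') (tau (nbhd A (f r')) (nbhd A r') i r')
  else default_action (val i) r'.
(* The default of [odflt] is never reached, because the image under the simulator is defined on all
   of [nbhd A r']. *)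
have sigma'E i r r' : R r r' ->
    tau (nbhd A r) (nbhd A r') i r' = Some (sigma' i r').
  move=> Rr; have exR : exists r, R r r' by exists r.
  rewrite /sigma' asboolT //.
  rewrite (simulation_nbhd (fP _ exR) Rr (rt_refl _ _ r')).
  have [_ domE] := tauP _ _ Rr i.
  have : dom (tau (nbhd A r) (nbhd A r') i) r' by rewrite domE; apply: nbhd_refl.
  by rewrite /dom /=; case: (tau _ _ i r').
exists sigma'.
  move=> i; split=> [r'|r' s' r's'].
    have [[r Rr]|noR] := pselect (exists r, R r r').
      by have [[h _] _] := tauP _ _ Rr i; apply: h (sigma'E i _ _ Rr).
    by rewrite /sigma' asboolF //; apply: default_action_avail.
  have [[r Rr]|noR] := pselect (exists r, R r r').
    (* By (1b), [s'] is related to some [s] indistinguishable from [r], so both values come from the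
       same partial strategy, which is uniform on its domain. *)
    have iA : val i \in A := valP i.
    have [s rs Rs] := simulation_indist iA Rr r's'.
    have nbhd' := eq_nbhd (indist_common iA r's').
    apply: Some_inj; rewrite -(sigma'E i _ _ Rr) -(sigma'E i _ _ Rs).
    rewrite -nbhd' -(eq_nbhd (indist_common iA rs)).
    have [[_ h] domE] := tauP _ _ Rr i.
    by apply: h => //; rewrite domE; [|rewrite nbhd']; apply: nbhd_refl.
  rewrite /sigma' !asboolF //; first exact: default_action_indist.
  (* A state related to [s'] would yield one related to [r'], by (1b) applied from [s']. *)
  case=> s Rs; apply: noR.
  by have [r _ Rr] := simulation_indist (valP i) Rs (indist_sym r's'); exists r.
move=> r r' s' Rr [a tr_a sigma'a].
have [_ _ h] := STP _ _ Rr.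
have [|s [b tr_b sigma_b] Rs] := h r r' (nbhd_refl A r) (nbhd_refl A r') Rr _
    (restrict_PStr (nbhd A r) sigmaP) s'.
  by exists a => // i; rewrite -sigma'a; apply: sigma'E.
exists s => //; exists b => // i.
by rewrite -sigma_b restrictE //; apply: nbhd_refl.
Qed.

Lemma lift_run (sigma : profile G A) (sigma' : profile G' A) :
    (forall r r' s', R r r' -> succ r' (to_partial sigma') s' ->
      exists2 s, succ r (to_partial sigma) s & R s s') ->
  forall q q' l', R q q' -> out_obj q' sigma' l' ->
  exists2 l, out_obj q sigma l & forall j, R (l j) (l' j).
Proof.
move=> lift q q' l' Rq [l'0 l'S].
(* Dependent choice: guarding the conclusion by relatedness makes the step function total, and the
   guard is then maintained along [st]. *)
have /choice[next nextP] (p : nat * state G) : exists t, R p.2 (l' p.1) ->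
    succ p.2 (to_partial sigma) t /\ R t (l' p.1.+1).
  case: p => j s; have [Rs|nRs] := pselect (R s (l' j)).
    by have [t st Rt] := lift _ _ _ Rs (l'S j); exists t.
  by exists s => /nRs.
pose st := fix st j := if j is k.+1 then next (k, st k) else q.
have stR j : R (st j) (l' j).
  elim: j => [|j IHj]; first by rewrite l'0.
  exact: (nextP (j, st j) IHj).2.
have stS j : succ (st j) (to_partial sigma) (st j.+1).
  exact: (nextP (j, st j) (stR j)).1.
(* Outcomes constrain only the states of a run, so any joint actions realising the transitions will
   do. *)
have /choice[act actP] j : exists a, trans (st j) a (st j.+1).
  by have [a tr_a _] := stS j; exists a.
by exists (Run actP).
Qed.

Lemma simulation_out x (sigma : profile G A) q q' : Str sigma -> R q q' ->
  exists2 sigma' : profile G' A, Str sigma' &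
    forall l', out x q' sigma' l' ->
      exists2 l, out x q sigma l & forall j, R (l j) (l' j).
Proof.
move=> /simulation_strategy[sigma' sigma'P /lift_run lift] Rq.
exists sigma' => //; case: x => l' /=; last exact: lift.
case=> i iA [r' r'q' outl'].
(* A subjective outcome may start at some [r'] other than [q']; (1b) supplies a matching start [r]
   indistinguishable from [q]. *)
have [r qr Rr] := simulation_indist iA Rq (indist_sym r'q').
have [l outl Rl] := lift _ _ _ Rr outl'.
by exists l => //; exists i => //; exists r => //; apply: indist_sym.
Qed.

(** Stated in one direction, so that it serves for [R] and for its converse alike. *)
Lemma simulation_can x psi q q' :
    (forall (l : run G) (l' : run G'), (forall j, R (l j) (l' j)) ->
      path_sat x l psi -> path_sat x l' psi) ->
  R q q' -> state_sat x q (Can A psi) -> state_sat x q' (Can A psi).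
Proof.
move=> psiP Rq [sigma sigmaP sat].
have [sigma' sigma'P outP] := simulation_out x sigmaP Rq.
by exists sigma' => // l' /outP[l /sat satl Rl]; apply: psiP satl.
Qed.

End Transfer.

(* Mutual induction on state and path formulas *)
Scheme state_formula_mut := Induction for state_formula Sort Prop
with path_formula_mut := Induction for path_formula Sort Prop.
Combined Scheme formula_mut from state_formula_mut, path_formula_mut.

(** States and runs are quantified after the formula, since the induction passes from a state to
    outcomes, and from a run to its first state and its suffixes. *)
Lemma bisimulation_sat (Ag : finType) (AP : Type) (G G' : iCGS Ag AP)
    (A : {set Ag}) (R : state G -> state G' -> Prop) x : bisimulation A R ->
  (forall phi : state_formula Ag AP, state_only A phi -> forall q q', R q q' ->
     (state_sat x q phi <-> state_sat x q' phi)) /\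
  (forall psi : path_formula Ag AP, path_only A psi ->
     forall (l : run G) (l' : run G'), (forall j, R (l j) (l' j)) ->
     (path_sat x l psi <-> path_sat x l' psi)).
Proof.
move=> [simR simR']; apply: formula_mut => /=.
- by move=> p _ q q' /(simulation_label simR)->.
- by move=> phi IH /IH{}IH q q' /IH->.
- move=> phi1 IH1 phi2 IH2 [/IH1 h1 /IH2 h2] q q' Rq.
  by have := h1 _ _ Rq; have := h2 _ _ Rq; tauto.
- move=> B psi IH [-> /IH{}IH] q q' Rq; split.
    by apply: (simulation_can simR) => // l l' /IH->.
  by apply: (simulation_can simR') => // l' l /IH->.
- by move=> phi IH /IH{}IH l l' Rl; apply: IH.
- by move=> psi IH /IH{}IH l l' /IH->.
- move=> psi1 IH1 psi2 IH2 [/IH1 h1 /IH2 h2] l l' Rl.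
  by have := h1 _ _ Rl; have := h2 _ _ Rl; tauto.
- by move=> psi IH /IH{}IH l l' Rl; apply: IH => j; apply: Rl.
- move=> psi1 IH1 psi2 IH2 [/IH1 h1 /IH2 h2] l l' Rl.
  have Rsuf k j : R (Defs.suffix l k j) (Defs.suffix l' k j) by apply: Rl.
  split=> -[j /(h2 _ _ (Rsuf j)) satj satk]; exists j => // k /satk.
    by move/(h1 _ _ (Rsuf k)).
  by move/(h1 _ _ (Rsuf k)).
Qed.

Theorem theorem8 (Ag : finType) (AP : Type) (G G' : iCGS Ag AP)
    (A : {set Ag}) (R : state G -> state G' -> Prop)
    (hR : bisimulation A R)
    (q : state G) (q' : state G') (hq : R q q')
    (l : run G) (l' : run G') (hl : forall j : nat, R (l j) (l' j))
    (x : semantics) :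
  (forall phi : state_formula Ag AP, state_only A phi ->
     (state_sat x q phi <-> state_sat x q' phi)) /\
  (forall psi : path_formula Ag AP, path_only A psi ->
     (path_sat x l psi <-> path_sat x l' psi)).
Proof.
have [state_inv path_inv] := bisimulation_sat x hR.
by split=> [phi /state_inv|psi /path_inv]; apply.
Qed.
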